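(* There exist integer sequences $\mathcal{N}=(n_j)_{j\ge1}$ given by $n_j=3j+\delta_j$ with $\delta_j\in\{0,1,2\}$ for every $j$, whose counting function satisfies $N(x)=x/3+O(1)$, and for which $\mathrm{LH}(\mathcal{N},x/3)$ is false.
   Context: For a sequence $\mathcal{N}=(n_j)_{j\ge1}$ of positive reals, $N(x)=\#\{j: n_j\le x\}$ denotes its counting function. For a differentiable function $M(x)$, the statement $\mathrm{LH}(\mathcal{N},M(x))$ (''the Lindelöf hypothesis for $\mathcal{N}$ with respect to $M$'') means: for every $\varepsilon>0$ and every $B>0$ there is a constant $C=C(\varepsilon,B)$ such that $$\Bigl|\sum_{n_j\le x} n_j^{-\mathrm{i} t}-\int_{n_1}^{x}u^{-\mathrm{i} t}M'(u)\,\mathrm{d}u\Bigr|\le C\, M(x)^{1/2}|t|^{\varepsilon}$$ for all real $t$ and all $x$ with $n_1\le x\le |t|^B$. ''False'' means this fails for some $\varepsilon>0$, $B>0$. *)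

(* Defs.v *)
From mathcomp Require Import all_boot all_order all_algebra.
From mathcomp Require Import finmap complex.
From mathcomp Require Import all_classical all_reals all_analysis.

Set Implicit Arguments.
Unset Strict Implicit.
Unset Printing Implicit Defensive.

Import Order.TTheory GRing.Theory Num.Theory.
Import numFieldNormedType.Exports.

Local Open Scope classical_set_scope.
Local Open Scope complex_scope.
Local Open Scope ring_scope.

Definition cexp (R : realType) (z : R[i]) : R[i] :=
  (expR (complex.Re z))%:C * (cos (complex.Im z) +i* sin (complex.Im z)).

(* Principal value; meaningful for u > 0 only. *)
Definition cpow (R : realType) (u : R) (s : R[i]) : R[i] :=
  cexp (s * (ln u)%:C).

Definition cintegral (R : realType) (A : set R) (f : R -> R[i]) : R[i] :=
  Rintegral lebesgue_measure A (fun u => complex.Re (f u)) +i*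
  Rintegral lebesgue_measure A (fun u => complex.Im (f u)).

(* Sequences (n_j), j >= 1, are functions on nat whose value at 0 is ignored. *)
Definition index_le (R : realType) (n : nat -> R) (x : R) : set nat :=
  [set j | (1 <= j)%N /\ n j <= x].

(* If index_le n x is infinite then fset_set returns the empty set and the
   \sum_(j \in _) in lindelof_hyp returns 0; both are the intended notions for
   sequences tending to infinity. *)
Definition counting_fun (R : realType) (n : nat -> R) (x : R) : nat :=
  #|` fset_set (index_le n x)|%fset.

(* M is meant to be differentiable and nonnegative on [n_1, +oo[. *)
Definition lindelof_hyp (R : realType) (n : nat -> R) (M : R -> R) : Prop :=
  forall eps B : R, 0 < eps -> 0 < B ->
  exists C : R, forall t x : R, n 1%N <= x -> x <= `|t| `^ B ->
    `| \sum_(j \in index_le n x) cpow (n j) (0 -i* t)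
       - cintegral `[n 1%N, x]
           (fun u => cpow u (0 -i* t) * (derive1 M u)%:C) |
    <= (C * Num.sqrt (M x) * `|t| `^ eps)%:C.

(* Main.v *)
Require Import Defs.
From mathcomp Require Import all_boot all_order all_algebra.
From mathcomp Require Import finmap complex.
From mathcomp Require Import all_classical all_reals all_analysis.
From mathcomp Require Import zify ring lra.

Import Order.TTheory GRing.Theory Num.Theory.
Import numFieldNormedType.Exports.

Local Open Scope classical_set_scope.
Local Open Scope ring_scope.

(* On the dyadic block 2^k <= j < 2^(k+1), take t = 3 pi 2^k. The phases of
   (3j)^(-it) and (3j+1)^(-it) then differ by an amount in [pi/2, pi], so the
   two numbers are at distance at least 1. Choosing delta_j in {0, 1} according
   to the sign of the real (or imaginary) part of their difference moves the
   sum over the block away from any prescribed number by at least 2^k / 4. The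
   prescribed number is the integral over the block. The choices on different
   blocks are independent, since subtracting the estimates of the Lindelof
   hypothesis at the two ends of a block isolates its contribution; but these
   estimates only allow O(2^(3k/4)) when epsilon = 1/4. *)

(** * Binary choices whose sum avoids a target *)

(** Taking the larger value at every index and taking the smaller one give sums that differ by
    exactly the left-hand side, so one of them lies at least half of it away from [w]. *)
Lemma sign_choice (R : realDomainType) (I : Type) (r : seq I) (a b : I -> R)
    (w : R) :
  exists s : I -> bool,
    \sum_(j <- r) `|a j - b j|
    <= 2 * `|\sum_(j <- r) (if s j then a j else b j) - w|.
Proof.
pose s j := b j <= a j.
pose S1 := \sum_(j <- r) (if s j then a j else b j).
pose S2 := \sum_(j <- r) (if ~~ s j then a j else b j).
have -> : \sum_(j <- r) `|a j - b j| = S1 - S2.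
  rewrite -sumrB; apply: eq_bigr => j _; rewrite /s.
  by case: lerP => h /=; lra.
have h : S1 - S2 <= `|S1 - w| + `|S2 - w|.
  by have := ler_norm (S1 - w); have := ler_norm (w - S2); rewrite distrC; lra.
have [h12|h12] := lerP `|S1 - w| `|S2 - w|.
- by exists (fun j => ~~ s j); rewrite -/S2; lra.
- by exists s; rewrite -/S1; lra.
Qed.

Lemma Re_sum (R : rcfType) (I : Type) (r : seq I) (f : I -> R[i]) :
  complex.Re (\sum_(j <- r) f j) = \sum_(j <- r) complex.Re (f j).
Proof. by apply: (big_morph (@complex.Re R)) => // -[a b] [c d]. Qed.

Lemma Im_sum (R : rcfType) (I : Type) (r : seq I) (f : I -> R[i]) :
  complex.Im (\sum_(j <- r) f j) = \sum_(j <- r) complex.Im (f j).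
Proof. by apply: (big_morph (@complex.Im R)) => // -[a b] [c d]. Qed.

Lemma normc_ge_Im (R : rcfType) (z : R[i]) :
  (`|complex.Im z|)%:C%C <= `|z|.
Proof.
rewrite normc_def lecR -sqrtr_sqr ler_sqrt ?lerDr ?sqr_ge0 //.
by rewrite addr_ge0 ?sqr_ge0.
Qed.

(** One coordinate, real or imaginary, carries at least half of the total distance [size r].
    Applying [sign_choice] to that coordinate costs another factor 2, hence the 4. *)
Lemma complex_choice (R : rcfType) (I : eqType) (r : seq I) (f g : I -> R[i])
    (w : R[i]) :
  (forall j, j \in r ->
     1 <= `|complex.Re (f j) - complex.Re (g j)|
          + `|complex.Im (f j) - complex.Im (g j)|) ->
  exists s : I -> bool,
    ((size r)%:R / 4)%:C%C
    <= `|\sum_(j <- r) (if s j then f j else g j) - w|.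
Proof.
move=> far.
have [s hs] := sign_choice R I r (fun j => complex.Re (f j))
  (fun j => complex.Re (g j)) (complex.Re w).
have [s' hs'] := sign_choice R I r (fun j => complex.Im (f j))
  (fun j => complex.Im (g j)) (complex.Im w).
have size_le : (size r)%:R <=
    \sum_(j <- r) `|complex.Re (f j) - complex.Re (g j)|
    + \sum_(j <- r) `|complex.Im (f j) - complex.Im (g j)|.
  rewrite -big_split /= -sum1_size natr_sum.
  by rewrite big_seq [leRHS]big_seq; apply: ler_sum.
set A := \sum_(j <- r) `|_| in hs size_le.
set B := \sum_(j <- r) `|_| in hs' size_le.
have [hA|hB] : (size r)%:R / 2 <= A \/ (size r)%:R / 2 <= B.
  by case: (lerP ((size r)%:R / 2) A) => h; [left|right]; lra.
- exists s; apply: le_trans (normc_ge_Re _); rewrite lecR.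
  rewrite raddfB /= Re_sum.
  under eq_bigr do rewrite (fun_if (@complex.Re R)).
  lra.
- exists s'; apply: le_trans (normc_ge_Im _ _); rewrite lecR.
  rewrite raddfB /= Im_sum.
  under eq_bigr do rewrite (fun_if (@complex.Im R)).
  lra.
Qed.

(** * Imaginary powers of [n] and [n + 1] *)

Lemma cpow_imE (R : realType) (u t : R) :
  cpow u (0 -i* t)%C = (cos (t * ln u) -i* sin (t * ln u))%C.
Proof.
rewrite /cpow /cexp /=; simpc.
by rewrite expR0 !mul1r ?mulNr cosN sinN.
Qed.

Lemma ln_succ_bounds (R : realType) (n : R) :
  0 < n -> (n + 1)^-1 <= ln (n + 1) - ln n <= n^-1.
Proof.
move=> n0; have n1 : 0 < n + 1 by lra.
apply/andP; split.
- have := @le_ln1Dx R (- (n + 1)^-1).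
  rewrite (_ : 1 - (n + 1)^-1 = n / (n + 1)); last by field; lra.
  rewrite lnM ?lnV ?posrE ?invr_gt0 // => h.
  suff: ln n - ln (n + 1) <= - (n + 1)^-1 by lra.
  by apply: h; rewrite ltrN2 invf_lt1 //; lra.
- have := @le_ln1Dx R n^-1.
  rewrite (_ : 1 + n^-1 = (n + 1) / n); last by field; lra.
  rewrite lnM ?lnV ?posrE ?invr_gt0 // => -> //.
  by apply: lt_trans (_ : 0 < _); rewrite ?invr_gt0 //; lra.
Qed.

Lemma cos_le0_pihalf_pi (R : realType) (x : R) :
  pi / 2 <= x <= pi -> cos x <= 0.
Proof.
move=> /andP[h1 h2]; have : 0 <= cos (pi - x).
  by apply: cos_ge0_pihalf; apply/andP; split; have := pi_gt0 R; lra.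
by rewrite cosB cospi sinpi; lra.
Qed.

Lemma cpow_succ_far (R : realType) (X n : R) :
  0 < X -> X <= n -> n + 1 <= 2 * X ->
  1 <= `|complex.Re (cpow (n + 1) (0 -i* (pi * X))%C)
         - complex.Re (cpow n (0 -i* (pi * X))%C)|
       + `|complex.Im (cpow (n + 1) (0 -i* (pi * X))%C)
           - complex.Im (cpow n (0 -i* (pi * X))%C)|.
Proof.
move=> X0 Xn nX; rewrite !cpow_imE /=.
have n0 : 0 < n by lra.
have pi0 := pi_gt0 R.
have /andP[l1 l2] := ln_succ_bounds R n n0.
set x := pi * X * ln (n + 1); set y := pi * X * ln n.
have : cos (x - y) <= 0.
  apply: cos_le0_pihalf_pi.
  rewrite (_ : x - y = pi * (X * (ln (n + 1) - ln n))); last first.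
    by rewrite /x /y; ring.
  rewrite -[X in _ <= _ <= X]mulr1 !ler_pM2l //; apply/andP; split.
  - apply: le_trans (_ : X * (n + 1)^-1 <= _); last by rewrite ler_pM2l.
    by rewrite ler_pdivlMr; lra.
  - apply: le_trans (_ : X * n^-1 <= _); first by rewrite ler_pM2l.
    by rewrite ler_pdivrMr; lra.
rewrite cosB => h.
have := cos2Dsin2 x; have := cos2Dsin2 y => hy hx.
set p := cos x - cos y; set q := - sin x - - sin y.
(* The squared distance between the two points of the unit circle is [2 - 2 * cos (x - y)]. *)
have pq : 2 <= `|p| ^+ 2 + `|q| ^+ 2.
  by rewrite !real_normK ?num_real // /p /q; nra.
have := normr_ge0 p; have := normr_ge0 q; nra.
Qed.

(** * Counting the perturbed progression *)

Section BoundedPerturbation.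
Variables (R : realType) (n delta : nat -> nat).
Hypothesis delta_le2 : forall j, (delta j <= 2)%N.
Hypothesis nE : forall j, (1 <= j)%N -> n j = (3 * j + delta j)%N.

(** Since [3 * j <= n j <= 3 * j + 2], the cutoff [3 * p - 1] separates the indices below [p] from
    the others, whatever [delta] is. *)
Lemma index_le_3p_pred (p : nat) : (0 < p)%N ->
  index_le (fun j => (n j)%:R : R) (3 * p).-1%:R = [set` index_iota 1 p].
Proof.
move=> p0; apply/seteqP; split=> j; rewrite /index_le /= mem_index_iota.
- move=> [j0]; rewrite ler_nat nE //; move: (delta_le2 j); lia.
- move=> /andP[j0 jp]; split => //; rewrite ler_nat nE //.
  by move: (delta_le2 j); lia.
Qed.

Lemma counting_fun_bound (x : R) : 0 <= x ->
  `|(counting_fun (fun j => (n j)%:R) x)%:R - x / 3| <= 2.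
Proof.
move=> x0; have /andP[qx xq] := truncn_itv x0.
set q := Num.truncn x in qx xq; pose p := (q %/ 3)%N.
(* As [p] is the integer part of [x / 3], the count is squeezed between [p - 1] and [p]. *)
have below : index_le (fun j => (n j)%:R) x `<=` [set` index_iota 1 p.+1].
  move=> j [j0 jx] /=; rewrite mem_index_iota.
  have : (n j < q.+1)%N by rewrite -(ltr_nat R); apply: le_lt_trans jx xq.
  by rewrite nE // /p; lia.
have above : [set` index_iota 1 p] `<=` index_le (fun j => (n j)%:R) x.
  move=> j /=; rewrite mem_index_iota => /andP[j0 jp]; split => //.
  apply: le_trans qx; rewrite ler_nat nE //.
  by move: (delta_le2 j) jp; rewrite /p; lia.
have fin := sub_finite_set below (finite_seq _).
have card_iota m : #|` fset_set [set` index_iota 1 m]|%fset = (m - 1)%N.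
  rewrite -[RHS](size_iota 1) -[in RHS](undup_id (iota_uniq _ _)) -card_fseq.
  congr (size (enum_fset _)); apply/fsetP => j.
  rewrite in_fset_set; last exact: finite_seq.
  by apply/idP/idP; rewrite !inE.
have le1 : (counting_fun (fun j => (n j)%:R) x <= p)%N.
  rewrite -[leqRHS](subn1 p.+1) -card_iota; apply: fsubset_leq_card.
  by rewrite -fset_set_sub //; exact: finite_seq.
have le2 : (p - 1 <= counting_fun (fun j => (n j)%:R) x)%N.
  by rewrite -card_iota; apply: fsubset_leq_card; rewrite -fset_set_sub //;
    exact: finite_seq.
set c := counting_fun _ _ in le1 le2 *.
have h1 : (3 * c)%:R <= q%:R :> R by rewrite ler_nat; move: le1; rewrite /p; lia.
have h2 : q.+1%:R <= (3 * c + 6)%:R :> R.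
  by rewrite ler_nat; move: le2; rewrite /p; lia.
rewrite ler_norml; move: h1 h2; rewrite natrD natrM => h1 h2.
by apply/andP; split; lra.
Qed.

End BoundedPerturbation.

(** * Dyadic blocks *)

Definition block_frequency (R : realType) (k : nat) : R :=
  pi * (3 * 2 ^ k)%:R.

(* The lower bound 3 is n_1, as delta_1 is taken to be 0. *)
Definition block_main_term (R : realType) (k : nat) : R[i] :=
  let I (x : R) := cintegral `[3, x] (fun u =>
    cpow u (0 -i* block_frequency R k)%C
    * (derive1 (fun x : R => x / 3) u)%:C%C) in
  I (3 * 2 ^ k.+1).-1%:R - I (3 * 2 ^ k).-1%:R.

Lemma block_choice (R : realType) (k : nat) :
  exists s : nat -> bool,
    ((2 ^ k)%:R / 4)%:C%C <=
    `|\sum_(2 ^ k <= j < 2 ^ k.+1)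
        cpow ((3 * j + s j)%:R) (0 -i* block_frequency R k)%C
      - block_main_term R k|.
Proof.
pose f (j : nat) := cpow (j%:R : R) (0 -i* block_frequency R k)%C.
have [j|s hs] := complex_choice R nat (index_iota (2 ^ k) (2 ^ k.+1))
  (fun j => f (3 * j + 1)%N) (fun j => f (3 * j)%N) (block_main_term R k).
  (* [cpow_succ_far] is used with [X = 3 * 2 ^ k] and [n = 3 * j]. *)
  rewrite mem_index_iota expnS => /andP[h1 h2].
  rewrite /f natrD; apply: cpow_succ_far.
  - by rewrite ltr0n muln_gt0 expn_gt0.
  - by rewrite ler_nat leq_mul2l.
  - by rewrite natr1 -natrM ler_nat; lia.
exists s.
have sz : size (index_iota (2 ^ k) (2 ^ k.+1)) = (2 ^ k)%N.
  by rewrite size_iota expnS; lia.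
rewrite sz in hs; apply: le_trans hs _.
rewrite le_eqVlt; apply/orP; left; apply/eqP; congr `|_ - _|.
by apply: eq_bigr => j _; case: (s j); rewrite /f ?addn0.
Qed.

(** With [m = 2 ^ k], the fourth power of the inequality clears both roots and reads
    [m ^ 4 <= K * m ^ 3], which would bound [2 ^ k] by [K]. *)
Lemma pow2_growth (R : realType) (C : R) :
  ~ forall k, (1 <= k)%N ->
    (2 ^ k)%:R / 4 <=
    2 * (C * Num.sqrt (2 ^ k.+1)%:R * block_frequency R k `^ (1 / 4)).
Proof.
move=> H.
pose K := 8 ^+ 4 * 12 * pi * C ^+ 4.
have pi0 := pi_gt0 R.
have K0 : 0 <= K.
  have C4 : 0 <= C ^+ 4 by apply: exprn_even_ge0.
  by apply: mulr_ge0 => //; apply: mulr_ge0; last exact: ltW.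
have bound k : (1 <= k)%N -> (2 ^ k)%:R <= K.
  move=> /H; rewrite expnS natrM; set m : R := (2 ^ k)%:R.
  have m0 : 0 < m by rewrite ltr0n expn_gt0.
  have t0 : 0 <= block_frequency R k.
    by rewrite /block_frequency mulr_ge0 // ltW.
  set s := Num.sqrt _; set q := _ `^ _ => h.
  have s2 : s ^+ 2 = 2 * m by rewrite sqr_sqrtr // mulr_ge0 // ltW.
  have q4 : q ^+ 4 = 3 * pi * m.
    rewrite -powR_mulrn ?powR_ge0 // -powRrM mul1r mulVf ?pnatr_eq0 //.
    by rewrite powRr1 // /block_frequency natrM -/m; ring.
  have h' : m / 8 <= C * s * q by lra.
  have : (m / 8) ^+ 4 <= (C * s * q) ^+ 4.
    by rewrite lerXn2r ?nnegrE //; [|apply: le_trans h']; apply: divr_ge0; lra.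
  rewrite !exprMn q4 (_ : s ^+ 4 = (s ^+ 2) ^+ 2); last by rewrite -exprM.
  rewrite s2 exprVn ler_pdivrMr ?exprn_gt0 //.
  rewrite (_ : C ^+ 4 * _ * _ * _ = K * m ^+ 3); last by rewrite /K; ring.
  by rewrite exprS ler_pM2r ?exprn_gt0.
have := archi_boundP K0; set N := Num.bound K => KN.
have := bound N.+1 isT; apply/negP; rewrite -ltNge.
by apply: lt_trans KN _; rewrite ltr_nat; apply: ltn_trans (ltn_expl _ _).
Qed.

(** * Gluing the blocks *)

Theorem theorem1p4 (R : realType) :
  exists n delta : nat -> nat,
    [/\ forall j : nat, (1 <= j)%N ->
          delta j \in [:: 0; 1; 2]%N /\ n j = (3 * j + delta j)%N,
        exists K : R, forall x : R, 0 <= x ->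
          `| (counting_fun (fun j => (n j)%:R) x)%:R - x / 3 | <= K
      & ~ lindelof_hyp (fun j => (n j)%:R) (fun x : R => x / 3) ].
Proof.
have [s hs] := choice (block_choice R).
(* [trunc_log 2 j] is the block containing [j]. The block [k = 0], which is [j = 1] alone, is
   sacrificed to fix [n 1 = 3]. *)
pose delta j : nat := if (j <= 1)%N then 0%N else s (trunc_log 2 j) j.
pose n j := (3 * j + delta j)%N.
have delta_le2 j : (delta j <= 2)%N by rewrite /delta; case: ifP; case: (s _ _).
have nE j : (1 <= j)%N -> n j = (3 * j + delta j)%N by [].
exists n, delta; split.
- by move=> j _; split=> //; rewrite /delta; case: ifP => // _; case: (s _ _).
- by exists 2; apply: counting_fun_bound delta_le2 nE.
move=> LH.
(* [B = 1] suffices: the cutoffs stay below [6 * 2 ^ k], which is at most [t] because [pi >= 2]. *)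
have [C HC] := LH (1 / 4) 1 ltac:(lra) ltr01.
apply: (@pow2_growth R `|C|) => k k1; rewrite -lecR.
set t := block_frequency R k.
have pi2 := pi_ge2 R.
have m0 : 0 < (2 ^ k)%:R :> R by rewrite ltr0n expn_gt0.
have t0 : 0 <= t by rewrite /t /block_frequency mulr_ge0 //; lra.
have m2 : (2 <= 2 ^ k)%N by rewrite -[X in (X <= _)%N]expn1 leq_exp2l.
pose I (x : R) := cintegral `[3, x] (fun u =>
    cpow u (0 -i* t)%C * (derive1 (fun x : R => x / 3) u)%:C%C).
(* One bound serves both ends of the block; [C] may be negative, hence its absolute value. The
   condition [2 <= p] puts the cutoff [3 * p - 1] above [n 1 = 3], which is why [k >= 1] is
   required. *)
have step p : (2 <= p)%N -> (p <= 2 ^ k.+1)%N ->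
    `|\sum_(1 <= j < p) cpow (n j)%:R (0 -i* t)%C - I (3 * p).-1%:R|
    <= (`|C| * Num.sqrt (2 ^ k.+1)%:R * t `^ (1 / 4))%:C%C.
  move=> p2 pk.
  have := HC t (3 * p).-1%:R.
  rewrite (_ : (n 1%N)%:R = 3 :> R) // (index_le_3p_pred _ n delta) //; last lia.
  rewrite -fsbig_seq ?iota_uniq // (ger0_norm t0) powRr1 // => h.
  apply: le_trans (h _ _) _; rewrite ?ler_nat; first lia.
  - apply: le_trans (_ : (2 * (3 * 2 ^ k))%:R <= _).
      by rewrite ler_nat; move: pk; rewrite expnS; lia.
    by rewrite natrM /t /block_frequency ler_wpM2r.
  rewrite lecR; apply: ler_wpM2r; first exact: powR_ge0.
  apply: le_trans (_ : `|C| * Num.sqrt ((3 * p).-1%:R / 3) <= _).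
    by rewrite ler_wpM2r ?sqrtr_ge0 ?ler_norm.
  rewrite ler_wpM2l // ler_sqrt ?ler0n // ler_pdivrMr // -natrM ler_nat.
  lia.
have kk : (2 ^ k <= 2 ^ k.+1)%N by rewrite leq_exp2l.
have h1 := step _ (leq_trans m2 kk) (leqnn _).
have h0 := step _ m2 kk.
apply: le_trans (hs k) _.
have -> : \sum_(2 ^ k <= j < 2 ^ k.+1) cpow (3 * j + s k j)%:R (0 -i* t)%C
    - block_main_term R k =
    (\sum_(1 <= j < 2 ^ k.+1) cpow (n j)%:R (0 -i* t)%C
      - I (3 * 2 ^ k.+1).-1%:R)
    - (\sum_(1 <= j < 2 ^ k) cpow (n j)%:R (0 -i* t)%C
      - I (3 * 2 ^ k).-1%:R).
  rewrite [X in _ = X - _ - _](@big_cat_nat _ _ _ (2 ^ k)%N) ?(ltnW m2) //=.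
  rewrite /block_main_term -/t -!/(I _).
  under eq_big_nat => j /andP[j1 j2].
    rewrite (_ : (3 * j + s k j)%N = n j); last first.
      rewrite /n /delta leqNgt (leq_trans m2 j1) /=.
      by rewrite (@trunc_log_eq 2 k) // j1.
    over.
  ring.
apply: le_trans (ler_normB _ _) _.
rewrite [2 * _]mulr_natl mulr2n rmorphD /=.
exact: lerD.
Qed.
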